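(* Let $n>1$ be an integer and let $d_1 > d_2$ be positive proper divisors of $n$. Write $d = d_1$ and let $Q$ be the set of prime divisors of $n$ that do not divide $d$. Then \[ \omega(X_n(d_1,d_2)) = \begin{cases} \min\left( \min_{p\in Q} p,\; f(n)\cdot f\left(\frac{n}{d}\right)\right), & \text{if } d_2 = 1,\\[2pt] \omega\left(X_{n/d_2}\left(1, \frac{d_1}{d_2}\right)\right), & \text{if } d_2 \mid d_1 \text{ and } d_2>1,\\[2pt] \max\left( f\left(\frac{n}{d_1}\right), f\left(\frac{n}{d_2}\right)\right), & \text{otherwise,}\end{cases} \] where, if $Q$ is empty, $\min_{p\in Q}p$ is interpreted as $+\infty$ (so the first case gives $f(n)\cdot f(n/d)$).
   Context: For an integer $n>1$ and a set $D$ of positive proper divisors of $n$, the gcd-graph $X_n(D)=X_n(d_1,\ldots,d_k)$ (where $D=\{d_1,\ldots,d_k\}$) has vertex set $\mathbb{Z}_n=\{0,1,\ldots,n-1\}$, and two distinct vertices $a,b$ are adjacent if and only if $\gcd(a-b,n)\in D$. For an integer $m>1$, $f(m)$ denotes the smallest prime divisor of $m$. $\omega$ denotes the clique number. *)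

(* Defs.v *)
From mathcomp Require Import all_boot all_order all_algebra.

Set Implicit Arguments.
Unset Strict Implicit.
Unset Printing Implicit Defensive.

(* The difference is taken in int, and absz makes it a natural number. *)
Definition gcd_graph (n : nat) (D : seq nat) : rel 'I_n :=
  fun a b => (a != b) && (gcdn `|(a%:Z - b%:Z)%R|%N n \in D).
Arguments gcd_graph : clear implicits.

Definition is_clique (T : finType) (e : rel T) (S : {set T}) : bool :=
  [forall x in S, forall y in S, (x != y) ==> e x y].

Definition clique_number (T : finType) (e : rel T) : nat :=
  \max_(S : {set T} | is_clique e S) #|S|.

(* min (min_(p in Q) p, m) with Q the set of primes dividing n but not d;
   starting the iterated minimum at m gives m when Q is empty, i.e. the
   minimum over Q then counts as +oo. *)
Definition min_primes_not_dvd (n d m : nat) : nat :=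
  \big[minn/m]_(p <- primes n | ~~ (p %| d)) p.

(* Main.v *)
(** Write [p = f(n)], [q = f(n/d)].  For [d2 = 1], vertices of a clique have
    distinct residues modulo every prime of [Q], and the pair (residue of [x]
    mod [p], residue of [x %/ d] mod [q]) determines [x] within a clique; this
    gives the upper bound.  For the lower bound, split [n = n1 * n2] with [n1]
    the part of [n] supported on the primes of [d]; then [n2] is supported on
    [Q], and the vertices [x_k] with [x_k = k %% p + d * (k %/ p)] mod [n1] and
    [x_k = k] mod [n2] form a clique.  If [d2] divides [d1], every clique is a
    translate of one made of multiples of [d2], and dividing by [d2] gives the
    second case.  If neither divides the other, a clique uses a single gcd. *)
Require Import Defs.
From mathcomp Require Import all_boot all_order all_algebra.
From mathcomp Require Import zify.

Import GRing.Theory.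

(** * Cliques as families of integers *)

(* A clique of size [m], listed by integer representatives of its vertices;
   these are automatically distinct mod [n] when [n] is not in [D]. *)
Definition gcd_family (n : nat) (D : seq nat) (m : nat) (x : nat -> int) :=
  forall i j, i < m -> j < m -> i != j -> gcdn `|(x i - x j)%R|%N n \in D.

Lemma gcdn_absz_modl (n : nat) (a b : int) :
  (a = b %[mod n])%Z -> gcdn `|a|%N n = gcdn `|b|%N n.
Proof.
move=> ab; have : gcdz a n = gcdz b n by rewrite -(gcdz_modl a) ab gcdz_modl.
by case.
Qed.

Lemma eqz_modB (n a b a' b' : int) :
  (a = b %[mod n])%Z -> (a' = b' %[mod n])%Z ->
  ((a - a')%R = (b - b')%R %[mod n])%Z.
Proof.
move=> /eqP + /eqP; rewrite !eqz_mod_dvd => ab ab'.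
apply/eqP; rewrite eqz_mod_dvd.
have -> : ((a - a') - (b - b') = (a - b) - (a' - b'))%R by lia.
exact: rpredB.
Qed.

(** Reduction mod [n] preserves the gcds. Two indices with the same residue would give the gcd [n],
    which is not in [D]. *)
Lemma gcd_family_le_clique_number (n : nat) (D : seq nat) (m : nat) x :
  0 < n -> n \notin D -> gcd_family n D m x -> m <= clique_number (gcd_graph n D).
Proof.
case: n => // n _ nD xP.
have modx_lt k : `|(x k %% n.+1)%Z|%N < n.+1 by lia.
pose g (i : 'I_m) := Ordinal (modx_lt i).
have gP i j : i != j -> gcdn `|((g i : nat)%:Z - (g j : nat)%:Z)%R|%N n.+1 \in D.
  move=> ij; have := xP i j (ltn_ord i) (ltn_ord j) ij.
  congr (_ \in D); apply: gcdn_absz_modl => /=.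
  have ->: Posz `|(x i %% n.+1)%Z|%N = (x i %% n.+1)%Z by lia.
  have ->: Posz `|(x j %% n.+1)%Z|%N = (x j %% n.+1)%Z by lia.
  by rewrite modzDml -[RHS]modzDmr modzNm modzDmr.
have g_inj : injective g.
  move=> i j gij; apply/eqP; apply/negPn/negP => /gP.
  by rewrite gij subrr gcd0n; apply/negP.
rewrite -[leqLHS](card_ord m) -(card_codom g_inj) -cardsE.
apply: (bigmax_sup [set y in codom g]) => //.
apply/forallP => a; apply/implyP; rewrite inE => /codomP[i ->].
apply/forallP => b; apply/implyP; rewrite inE => /codomP[j ->].
apply/implyP => gij; rewrite /gcd_graph gij gP //.
by apply: contra gij => /eqP ->.
Qed.

Lemma clique_number_family (n : nat) (D : seq nat) :
  exists x, gcd_family n D (clique_number (gcd_graph n D)) x.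
Proof.
have : 0 < #|[pred S : {set 'I_n} | is_clique (gcd_graph n D) S]|.
  apply/card_gt0P; exists set0; rewrite inE.
  by apply/forallP => a; rewrite inE.
case/(eq_bigmax_cond (fun S : {set 'I_n} => #|S|)) => S; rewrite inE => SP.
rewrite /clique_number => ->.
(* The default [0] is returned only for indices from [#|S|] on, about which [gcd_family] says
   nothing. *)
exists (fun i => Posz (nth 0 (map (@nat_of_ord n) (enum S)) i)) => i j iS jS ij.
have [a0 _] : exists a, a \in S by apply/card_gt0P; lia.
have eS : size (enum S) = #|S| by rewrite -cardE.
rewrite !(nth_map a0) ?eS //.
have inS k : k < #|S| -> nth a0 (enum S) k \in S.
  by move=> kS; rewrite -mem_enum mem_nth ?eS.
move/forallP/(_ (nth a0 (enum S) i)): SP; rewrite inS //=.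
move/forallP/(_ (nth a0 (enum S) j)); rewrite inS //=.
by rewrite nth_uniq ?enum_uniq ?eS // ij => /andP[].
Qed.

(** * Upper bounds by counting residues *)

(** Pigeonhole on pairs of residues; taking one modulus to be 1 leaves a bound from a single
    residue. *)
Lemma residue_pair_bound (m p q : nat) (y z : nat -> int) :
  0 < p -> 0 < q ->
  (forall i j, i < m -> j < m -> (p %| (y i - y j)%R)%Z -> (q %| (z i - z j)%R)%Z -> i = j) ->
  m <= p * q.
Proof.
move=> p0 q0 yzP.
have ylt k : `|(y k %% p)%Z|%N < p by lia.
have zlt k : `|(z k %% q)%Z|%N < q by lia.
pose g (i : 'I_m) := (Ordinal (ylt i), Ordinal (zlt i)).
have g_inj : injective g.
  move=> i j [yij zij]; apply/val_inj/yzP; rewrite ?ltn_ord //.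
    by rewrite -eqz_mod_dvd; apply/eqP; lia.
  by rewrite -eqz_mod_dvd; apply/eqP; lia.
by have := leq_card g g_inj; rewrite card_prod !card_ord.
Qed.

(** Since [d] divides [a - b], the quotients differ by [(a - b) / d]. If the prime
    [q = pdiv (n %/ d)] divided that, [q * d] would divide both [a - b] and [n], hence their gcd
    [d]. *)
Lemma gcdn_quotient_residue (n d : nat) (a b : int) :
  0 < d -> d < n -> gcdn `|(a - b)%R|%N n = d ->
  ~~ (pdiv (n %/ d) %| ((a %/ d)%Z - (b %/ d)%Z)%R)%Z.
Proof.
move=> d0 dn gd; apply/negP.
have d_dvd : d %| n by rewrite -gd dvdn_gcdr.
have nd1 : 1 < n %/ d by rewrite ltn_divRL // mul1n.
have /dvdzP[t abt] : (d %| (a - b)%R)%Z by rewrite dvdzE /= -{1}gd dvdn_gcdl.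
have -> : a = (b + t * d)%R by rewrite -abt addrC subrK.
rewrite divzDr ?dvdz_mull ?dvdzz // mulzK; last lia.
rewrite addrC addrA addNr add0r => qt.
have : pdiv (n %/ d) * d %| gcdn `|(a - b)%R|%N n.
  rewrite dvdn_gcd abt abszM /= dvdn_pmul2r //; apply/andP; split; first exact: qt.
  by rewrite -{2}(divnK d_dvd) dvdn_pmul2r // pdiv_dvd.
rewrite gd -[X in _ %| X]mul1n dvdn_pmul2r // dvdn1 => /eqP q1.
by have := pdiv_prime nd1; rewrite q1.
Qed.

Lemma gcd_family1_bound (n d m : nat) x :
  0 < d -> d < n -> gcd_family n [:: d] m x -> m <= pdiv (n %/ d).
Proof.
move=> d0 dn xP; rewrite -[leqRHS]mul1n.
apply: (residue_pair_bound _ _ _ x (fun i => (x i %/ d)%Z)) => //.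
move=> i j im jm _; apply: contraTeq => ij.
apply: gcdn_quotient_residue => //.
by have := xP i j im jm ij; rewrite inE => /eqP.
Qed.

(** * Cliques in arithmetic progression *)

Lemma coprime_no_prime (a b : nat) : 0 < b ->
  (forall p, prime p -> p %| a -> p %| b -> False) -> coprime a b.
Proof.
move=> b0 ab; rewrite /coprime; apply/negPn/negP => g1.
have {}g1 : 1 < gcdn a b by rewrite ltn_neqAle eq_sym g1 gcdn_gt0 b0 orbT.
have := ab _ (pdiv_prime g1).
have := pdiv_dvd (gcdn a b); rewrite dvdn_gcd => /andP[-> ->].
by move=> /(_ isT isT).
Qed.

Lemma not_dvdn_dist (r i j : nat) : i < r -> j < r -> i != j ->
  ~~ (r %| `|(i%:Z - j%:Z)%R|%N).
Proof. by move=> ir jr ij; apply/negP => /dvdn_leq; lia. Qed.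

(** The gcd is [d] times that of [i - j] and [n %/ d], and a nonzero [i - j] is smaller in absolute
    value than every prime divisor of [n %/ d]. *)
Lemma gcdn_scaled_dist (n d i j : nat) : 0 < d -> 0 < n -> d %| n -> i != j ->
  (forall p, prime p -> p %| n %/ d -> maxn i j < p) ->
  gcdn `|((d * i)%N%:Z - (d * j)%N%:Z)%R|%N n = d.
Proof.
move=> d0 n0 dn ij ijP.
rewrite !PoszM -mulrBr abszM /= -[n in gcdn _ n](divnK dn).
rewrite [X in gcdn _ X]mulnC -muln_gcdr.
suff /eqP -> : coprime `|(i%:Z - j%:Z)%R|%N (n %/ d) by rewrite muln1.
apply: coprime_no_prime => [|p p_pr pij pn]; first by rewrite divn_gt0 // dvdn_leq.
have := ijP p p_pr pn; rewrite gtn_max => /andP[ip jp].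
by case/negP: (not_dvdn_dist _ _ _ ip jp ij).
Qed.

Lemma arithmetic_gcd_family (n d : nat) : 0 < d -> d %| n -> d < n ->
  gcd_family n [:: d] (pdiv (n %/ d)) (fun i => Posz (d * i)).
Proof.
move=> d0 dn d_lt i j iq jq ij; rewrite inE; apply/eqP.
apply: gcdn_scaled_dist => // [|p p_pr pn]; first lia.
by have := pdiv_min_dvd (prime_gt1 p_pr) pn; lia.
Qed.

Lemma gcd_family_sub (n : nat) (D D' : seq nat) (m : nat) x :
  {subset D <= D'} -> gcd_family n D m x -> gcd_family n D' m x.
Proof. by move=> sD xP i j im jm ij; apply/sD/xP. Qed.

(** * Incomparable divisors *)

(* Neither of [d1], [d2] divides the other, so every triangle of the clique,
   hence the whole clique, uses a single gcd. *)
Lemma gcd_family_monochromatic (n d1 d2 m : nat) x :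
  d1 %| n -> d2 %| n -> ~~ (d1 %| d2) -> ~~ (d2 %| d1) ->
  gcd_family n [:: d1; d2] m x ->
  gcd_family n [:: d1] m x \/ gcd_family n [:: d2] m x.
Proof.
move=> d1n d2n d12 d21 xP.
pose g i j := gcdn `|(x i - x j)%R|%N n.
have gC i j : g i j = g j i by rewrite /g distnC.
have gP i j : i < m -> j < m -> i != j -> g i j = d1 \/ g i j = d2.
  move=> im jm ij; have := xP i j im jm ij; rewrite !inE -/(g i j).
  by case/orP => /eqP ->; [left | right].
have trans d i j k : d %| n -> d %| g i j -> d %| g j k -> d %| g i k.
  move=> dn; rewrite !dvdn_gcd => /andP[ij _] /andP[jk _]; rewrite dn andbT.
  have : ((x i - x j) + (x j - x k) \in dvdz d)%R by apply: rpredD.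
  by rewrite subrKA.
(* Two of the three gcds of a triangle agree; by [trans] their common value divides the third, which
   then cannot be the other divisor. *)
have tri i j k : i < m -> j < m -> k < m -> i != j -> j != k -> i != k ->
    g i j = g i k.
  move=> im jm km ij jk ik.
  have := trans d1 j i k d1n; have := trans d2 j i k d2n.
  have := trans d1 i j k d1n; have := trans d2 i j k d2n.
  have := trans d1 i k j d1n; have := trans d2 i k j d2n.
  rewrite (gC k j) (gC j i).
  case: (gP i j) (gP i k) (gP j k) => // -> [] // -> [] // ->;
    rewrite !dvdnn ?(negPf d12) ?(negPf d21); do 6! [by move/(_ isT isT) | move=> _].
have [m1|m1] := leqP m 1; first by left=> i j; lia.
(* Every edge is compared with the edge from 0 to 1 through edges at the vertex 0. *)
have mono i j : i < m -> j < m -> i != j -> g i j = g 0 1.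
  have g0 k : k < m -> k != 0 -> g 0 k = g 0 1.
    move=> km k0; have [-> //|k1] := eqVneq k 1.
    by apply: tri; rewrite // ?(ltnW m1) 1?eq_sym.
  move=> im jm ij; have [i0|i0] := eqVneq i 0; first by rewrite i0 g0 // -i0 eq_sym.
  have [->|j0] := eqVneq j 0; first by rewrite gC g0.
  by rewrite (tri i j 0 im jm (ltnW m1) ij j0 i0) gC g0.
have [] := gP 0 1 (ltnW m1) m1 isT => g01; [left | right];
  by move=> i j im jm ij; rewrite inE -/(g i j) mono // g01.
Qed.

Lemma clique_number_incomparable (n d1 d2 : nat) :
  0 < d1 -> d1 %| n -> d1 < n -> 0 < d2 -> d2 %| n -> d2 < n ->
  ~~ (d1 %| d2) -> ~~ (d2 %| d1) ->
  clique_number (gcd_graph n [:: d1; d2]) = maxn (pdiv (n %/ d1)) (pdiv (n %/ d2)).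
Proof.
move=> d1_gt0 d1n d1_lt d2_gt0 d2n d2_lt d12 d21.
apply/eqP; rewrite eqn_leq; apply/andP; split; last first.
  have nD : n \notin [:: d1; d2] by rewrite !inE; lia.
  rewrite geq_max; apply/andP; split.
    apply: gcd_family_le_clique_number nD _; first lia.
    apply: gcd_family_sub (arithmetic_gcd_family _ _ d1_gt0 d1n d1_lt).
    by move=> a; rewrite !inE => ->.
  apply: gcd_family_le_clique_number nD _; first lia.
  apply: gcd_family_sub (arithmetic_gcd_family _ _ d2_gt0 d2n d2_lt).
  by move=> a; rewrite !inE => ->; rewrite orbT.
have [x] := clique_number_family n [:: d1; d2].
rewrite leq_max; case/gcd_family_monochromatic => // /gcd_family1_bound -> //.
by rewrite orbT.
Qed.

(** * Scaling by a common divisor *)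

Lemma clique_number_divisible (n d e : nat) :
  0 < d -> d %| n -> d < n -> d %| e -> e < n ->
  clique_number (gcd_graph n [:: e; d]) =
  clique_number (gcd_graph (n %/ d) [:: 1; e %/ d]).
Proof.
move=> d0 dn d_lt de e_lt.
have nd0 : 1 < n %/ d by rewrite ltn_divRL // mul1n.
have scale (y : int) :
    (gcdn `|(y * d)%R|%N n \in [:: e; d]) =
    (gcdn `|y|%N (n %/ d) \in [:: 1; e %/ d]).
  rewrite abszM /= -{1}(divnK dn) -muln_gcdl !inE orbC.
  by rewrite -(@eqn_pmul2r d _ 1) // -(@eqn_pmul2r d _ (e %/ d)) // mul1n divnK.
apply/eqP; rewrite eqn_leq; apply/andP; split.
  have [x xP] := clique_number_family n [:: e; d].
  apply: (@gcd_family_le_clique_number _ _ _ (fun i => ((x i - x 0)%R %/ d)%Z)).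
  - lia.
  - rewrite !inE; apply/negP => /orP[|]/eqP; first lia.
    by move/(congr1 (muln^~ d)); rewrite !divnK //; lia.
  move=> i j im jm ij; rewrite -scale.
  (* Both allowed gcds are multiples of [d], so translating by [x 0] moves the whole clique into the
     multiples of [d]. *)
  have dvd k : k < clique_number (gcd_graph n [:: e; d]) -> (d %| (x k - x 0)%R)%Z.
    move=> km; have [->|k0] := eqVneq k 0; first by rewrite subrr dvdz0.
    have /(_ k0) := xP k 0 km (leq_ltn_trans (leq0n _) km).
    have := dvdn_gcdl `|(x k - x 0)%R|%N n; rewrite dvdzE !inE.
    by move=> + /orP[]/eqP E; rewrite E //; apply: dvdn_trans.
  rewrite mulrBl !divzK ?dvd // (_ : (_ - _ = x i - x j)%R); first exact: xP.
  by rewrite opprB addrA subrK.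
have [x xP] := clique_number_family (n %/ d) [:: 1; e %/ d].
apply: (@gcd_family_le_clique_number _ _ _ (fun i => (x i * d)%R)).
- lia.
- by rewrite !inE; lia.
by move=> i j im jm ij; rewrite -mulrBl scale xP.
Qed.

(** * The divisor pair [d], 1 *)

Lemma leq_min_primes_not_dvd (n d m k : nat) : 0 < n ->
  reflect (k <= m /\ forall p, prime p -> p %| n -> ~~ (p %| d) -> k <= p)
          (k <= min_primes_not_dvd n d m).
Proof.
move=> n0; rewrite /min_primes_not_dvd.
have -> : (k <= \big[minn/m]_(p <- primes n | ~~ (p %| d)) p) =
    (k <= m) && all (fun p => ~~ (p %| d) ==> (k <= p)) (primes n).
  elim: (primes n) => [|p s IH]; first by rewrite big_nil andbT.
  rewrite big_cons /=; case: ifP => //= _.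
  by rewrite leq_min IH andbCA.
apply: (iffP andP) => -[km kP]; split=> //.
  by move=> p p_pr pn; move/allP/(_ p): kP; rewrite mem_primes p_pr n0 pn => /(_ isT)/implyP.
by apply/allP => p; rewrite mem_primes => /and3P[p_pr _ pn]; apply/implyP/kP.
Qed.

Lemma clique_number_unit (n d : nat) :
  1 < d -> d %| n -> d < n ->
  clique_number (gcd_graph n [:: d; 1]) =
  min_primes_not_dvd n d (pdiv n * pdiv (n %/ d)).
Proof.
move=> d1 dn d_lt; have n0 : 0 < n by lia.
have d0 : 0 < d by lia.
have nd1 : 1 < n %/ d by rewrite ltn_divRL // mul1n.
apply/eqP; rewrite eqn_leq; apply/andP; split.
  have [x xP] := clique_number_family n [:: d; 1].
  apply/leq_min_primes_not_dvd => //; split=> [|r r_pr rn rd].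
    apply: (residue_pair_bound _ _ _ x (fun i => (x i %/ d)%Z)); rewrite ?pdiv_gt0 //.
    move=> i j im jm pij qij; apply/eqP; apply: contraLR qij => ij.
    apply: gcdn_quotient_residue => //.
    (* The prime [pdiv n] divides the difference, which excludes the gcd 1 and leaves [d]. *)
    have := xP i j im jm ij; rewrite !inE => /orP[/eqP //|/eqP g1].
    have : pdiv n %| gcdn `|(x i - x j)%R|%N n by rewrite dvdn_gcd pdiv_dvd andbT.
    rewrite g1 dvdn1 => /eqP p1.
    have n1 : 1 < n by lia.
    by have := pdiv_prime n1; rewrite p1.
  (* A prime [r] of [Q] divides neither [d] nor 1, so residues mod [r] are distinct; the second
     modulus is 1. *)
  rewrite -[leqRHS]muln1.
  apply: (residue_pair_bound _ _ _ x x) => //; first exact: prime_gt0.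
  move=> i j im jm rij _; apply/eqP; apply: contraLR rij => ij; apply/negP => rij.
  have : r %| gcdn `|(x i - x j)%R|%N n by rewrite dvdn_gcd rn andbT.
  have := xP i j im jm ij; rewrite !inE => /orP[] /eqP ->; first exact/negP.
  by rewrite dvdn1 => /eqP r1; rewrite r1 in r_pr.
set M := min_primes_not_dvd _ _ _.
(* The characterization of lower bounds, applied to [M] itself. *)
have [Mpq MQ] : M <= pdiv n * pdiv (n %/ d) /\
    forall p, prime p -> p %| n -> ~~ (p %| d) -> M <= p.
  by apply/leq_min_primes_not_dvd.
set p := pdiv n in Mpq; set q := pdiv (n %/ d) in Mpq.
have p0 : 0 < p by exact: pdiv_gt0.
set n1 := n`_\pi(d); set n2 := n`_\pi(d)^'.
have n12 : n1 * n2 = n by exact: partnC.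
have co12 : coprime n1 n2 by exact: coprime_partC.
have [n1_gt0 n2_gt0] : 0 < n1 /\ 0 < n2 by rewrite !part_gt0.
have d_n1 : d %| n1.
  by rewrite -[d](part_pnat_id (pnat_pi d0)); apply: partn_dvd.
pose a k := (k %% p + d * (k %/ p))%N.
pose x k := zchinese n1 n2 (a k) k.
have q_min r : prime r -> r %| n %/ d -> q <= r.
  by move=> /prime_gt1; apply: pdiv_min_dvd.
have div_lt k : k < M -> k %/ p < q.
  by move=> kM; rewrite ltn_divLR // mulnC (leq_trans kM).
have x_n1 i j : ((x i - x j)%R = (Posz (a i) - Posz (a j))%R %[mod n1])%Z.
  by apply: eqz_modB; apply: zchinese_modl.
have x_n2 i j : ((x i - x j)%R = (Posz i - Posz j)%R %[mod n2])%Z.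
  by apply: eqz_modB; apply: zchinese_modr.
apply: (@gcd_family_le_clique_number _ _ _ x) => //; first by rewrite !inE; lia.
(* The factor [n2] adds nothing to the gcd: there the difference is [i - j], and every prime of [n2]
   is at least [M], hence exceeds its absolute value. *)
move=> i j iM jM ij; rewrite -n12 Gauss_gcdl; last first.
  rewrite /coprime (gcdn_absz_modl _ _ _ (x_n2 i j)).
  apply: coprime_no_prime => // r r_pr rij rn2.
  have rd : ~~ (r %| d).
    have := pnatP _ n2_gt0 (part_pnat \pi(d)^' n) r r_pr rn2.
    by rewrite !inE mem_primes r_pr d0.
  have rn : r %| n by rewrite -n12 dvdn_mull.
  have Mr := MQ r r_pr rn rd.
  by case/negP: (not_dvdn_dist _ _ _ (leq_trans iM Mr) (leq_trans jM Mr) ij).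
rewrite (gcdn_absz_modl _ _ _ (x_n1 i j)) !inE /a.
(* With equal low digits, [a i - a j] is [d] times a difference of high digits; these are below [q],
   the least prime of [n %/ d], so the gcd is [d]. *)
have [eij|nij] := eqVneq (i %% p) (j %% p).
  rewrite eij distnDl gcdn_scaled_dist ?eqxx //.
    by apply: contra ij => /eqP e; rewrite (divn_eq i p) (divn_eq j p) e eij.
  move=> r r_pr rn1; rewrite gtn_max.
  have rn : r %| n %/ d by rewrite -n12 mulnC -muln_divA // dvdn_mull.
  by rewrite !(leq_trans (div_lt _ _) (q_min r r_pr rn)).
(* With distinct low digits the gcd is 1: a prime [r] of [n1] divides [d], so it would divide the
   difference of the low digits, which are below [p <= r]. *)
apply/orP; right; apply: coprime_no_prime => // r r_pr rij rn1.
have rd : r %| d.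
  have := pnatP _ n1_gt0 (part_pnat \pi(d) n) r r_pr rn1.
  by rewrite mem_primes d0 => /and3P[].
have pr : p <= r.
  by apply: pdiv_min_dvd; [exact: prime_gt1 | rewrite (dvdn_trans rd)].
have {}rij : (r %| (Posz (i %% p) - Posz (j %% p))%R)%Z.
  have rdk k : (r %| Posz (d * k))%Z by rewrite dvdzE dvdn_mulr.
  have /rpredDr <- : (Posz (d * (i %/ p)) - Posz (d * (j %/ p)))%R \in dvdz r.
    exact: rpredB.
  by rewrite addrACA -opprD -!PoszD.
have mod_lt k : k %% p < r by rewrite (leq_trans (ltn_pmod k p0)).
by case/negP: (not_dvdn_dist _ _ _ (mod_lt i) (mod_lt j) nij).
Qed.

Theorem theorem3p1 (n d1 d2 : nat)
    (n_gt1 : 1 < n)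
    (d1_gt0 : 0 < d1) (d1_dvd : d1 %| n) (d1_lt : d1 < n)
    (d2_gt0 : 0 < d2) (d2_dvd : d2 %| n) (d2_lt : d2 < n)
    (d2_lt_d1 : d2 < d1) :
  clique_number (gcd_graph n [:: d1; d2]) =
    if d2 == 1 then
      min_primes_not_dvd n d1 (pdiv n * pdiv (n %/ d1))
    else if d2 %| d1 then
      clique_number (gcd_graph (n %/ d2) [:: 1; d1 %/ d2])
    else maxn (pdiv (n %/ d1)) (pdiv (n %/ d2)).
Proof.
have [d2_1|_] := eqVneq d2 1.
  by rewrite d2_1 clique_number_unit // -d2_1.
case: ifP => [d21|/negbT d21]; first exact: clique_number_divisible.
apply: clique_number_incomparable => //.
by apply/negP => /(dvdn_leq d2_gt0); lia.
Qed.
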